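(* Let $n=6k+r$ with integers $k\ge 1$ and $r\in\{0,1,\dots,5\}$. Then $$\gamma_{LTD}(M(P_n))\le\begin{cases}4k+2 & \text{if } r=0,\\ 4k+r+1 & \text{if } r\in\{1,2,3\},\\ 4k+r & \text{if } r\in\{4,5\}.\end{cases}$$ Moreover, for every $n\ge 3$, $$\gamma_{LTD}(M(C_n))\le\begin{cases} n-\left\lfloor\frac n3\right\rfloor+2 & \text{if } n \text{ is odd},\\ n-2\left\lfloor\frac n6\right\rfloor+2 & \text{if } n \text{ is even}.\end{cases}$$
   Context: All graphs are finite, simple and connected. For a graph $G=(V,E)$ and $x\in V$, $N(x)$ is the open neighbourhood. A set $C\subseteq V$ is a locating total-dominating set ($LTD$-set) if $N(x)\cap C\neq\emptyset$ for all $x\in V$ and $N(x)\cap C\neq N(y)\cap C$ for all distinct $x,y\in V\setminus C$; $\gamma_{LTD}(G)$ is the minimum size of an $LTD$-set. $P_n$ is the path and $C_n$ the cycle on $n$ vertices. The Mycielski graph $M(G)$ of $G$ with $V=\{v_1,\dots,v_n\}$ is obtained from $G$ by adding, for each $i$, a new vertex $u_i$ adjacent to every vertex of $N_G(v_i)$, and then adding one further vertex $u$ adjacent to all of $u_1,\dots,u_n$ (and to nothing else). *)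

(* Defs.v *)
From mathcomp Require Import all_boot.

Set Implicit Arguments.
Unset Strict Implicit.
Unset Printing Implicit Defensive.

Record sgraph := SGraph {
  vertex :> finType;
  adj : rel vertex;
  adj_sym : symmetric adj;
  adj_irr : irreflexive adj
}.

Definition nbh (G : sgraph) (x : G) : {set G} := [set y | adj x y].

Definition LTD_set (G : sgraph) (C : {set G}) : bool :=
  [forall x : G, nbh x :&: C != set0] &&
  [forall x : G, forall y : G,
     [&& x \notin C, y \notin C & x != y] ==>
     (nbh x :&: C != nbh y :&: C)].

(* The minimum is only meaningful when the whole vertex set is an LTD-set, i.e.
   when G has no isolated vertex; otherwise there is no LTD-set at all and the
   value defaults to the order of G. *)
Definition gamma_LTD (G : sgraph) : nat :=
  #|[arg min_(C < [set: G] | LTD_set C) #|C| ]|.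

Lemma LTD_setT (G : sgraph) :
  LTD_set [set: G] = [forall x : G, exists y : G, adj x y].
Proof.
rewrite /LTD_set; set B := (X in _ && X).
have -> : B by apply/forallP => x; apply/forallP => y; rewrite in_setT.
rewrite andbT; apply: eq_forallb => x; rewrite setIT.
apply/set0Pn/existsP => [[y]|[y xy]]; first by rewrite inE; exists y.
by exists y; rewrite inE.
Qed.

Lemma gamma_LTDP (G : sgraph) : (forall x : G, exists y : G, adj x y) ->
  (exists2 C : {set G}, LTD_set C & #|C| = gamma_LTD G) /\
  (forall C : {set G}, LTD_set C -> gamma_LTD G <= #|C|).
Proof.
move=> noiso; have LT : LTD_set [set: G].
  by rewrite LTD_setT; apply/forallP => x; apply/existsP; apply: noiso.
by rewrite /gamma_LTD; case: arg_minnP => // C HC Hmin; split=> //; exists C.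
Qed.

Definition path_adj (n : nat) : rel 'I_n :=
  fun i j => (i.+1 == j :> nat) || (j.+1 == i :> nat).

Lemma path_adj_sym n : symmetric (@path_adj n).
Proof. by move=> i j; rewrite /path_adj orbC. Qed.

Lemma path_adj_irr n : irreflexive (@path_adj n).
Proof. by move=> i; rewrite /path_adj orbb; apply: gtn_eqF. Qed.

Definition path_graph (n : nat) : sgraph :=
  SGraph (@path_adj_sym n) (@path_adj_irr n).

(* ordS is the cyclic successor on 'I_n.  The conjunct i != j only matters for
   n = 1, where it removes a loop; the cycle C_n is meant for n >= 3. *)
Definition cycle_adj (n : nat) : rel 'I_n :=
  fun i j => (i != j) && ((ordS i == j) || (ordS j == i)).

Lemma cycle_adj_sym n : symmetric (@cycle_adj n).
Proof. by move=> i j; rewrite /cycle_adj eq_sym orbC. Qed.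

Lemma cycle_adj_irr n : irreflexive (@cycle_adj n).
Proof. by move=> i; rewrite /cycle_adj eqxx. Qed.

Definition cycle_graph (n : nat) : sgraph :=
  SGraph (@cycle_adj_sym n) (@cycle_adj_irr n).

(* Some (inl v) is the original vertex v, Some (inr v) its copy, and None the
   vertex joined to all the copies. *)
Definition mycielski_adj (G : sgraph) : rel (option (G + G)) :=
  fun x y => match x, y with
  | Some (inl v), Some (inl w) => adj v w
  | Some (inl v), Some (inr w) => adj v w
  | Some (inr v), Some (inl w) => adj v w
  | Some (inr _), None => true
  | None, Some (inr _) => true
  | _, _ => false
  end.

Lemma mycielski_adj_sym (G : sgraph) : symmetric (@mycielski_adj G).
Proof. by move=> [[v|v]|] [[w|w]|] //=; apply: adj_sym. Qed.

Lemma mycielski_adj_irr (G : sgraph) : irreflexive (@mycielski_adj G).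
Proof. by move=> [[v|v]|] //=; apply: adj_irr. Qed.

Definition mycielski (G : sgraph) : sgraph :=
  SGraph (@mycielski_adj_sym G) (@mycielski_adj_irr G).

(* Main.v *)
Require Import Defs.
From mathcomp Require Import all_boot.
From mathcomp Require Import zify.

(** Take the apex u together with a set A of original vertices and the copies
    of a set B.  The apex tells copies from originals, so the copies outside B
    only need distinct traces N(x) :&: A.  When x |-> N(x) :&: A is injective on
    all of G, a single copy suffices and the cost is |A| + 2.

    For paths and cycles N(x) consists of the two vertices around x, so the
    trace is injective as long as the vertices missing from A are never at
    distance 2 or 4 (with one exceptional empty trace, and boundary conditions
    on paths); such sets A of density 2/3 are given explicitly modulo 6 or 3.
    For paths with n = 6k+4 no such A is small enough: there two pairs of
    traces coincide, and a set B of two vertices resolves them. *)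

Set Implicit Arguments.
Unset Strict Implicit.
Unset Printing Implicit Defensive.

(** * Bounds for the Mycielski graph of an arbitrary graph *)

Lemma gamma_LTD_le (G : sgraph) (C : {set G}) :
  LTD_set C -> gamma_LTD G <= #|C|.
Proof.
(* The existence of [C] excludes isolated vertices, so [gamma_LTD] is a true minimum. *)
move=> ltdC; apply: (proj2 (gamma_LTDP _)) => // x.
case/andP: ltdC => /forallP/(_ x)/set0Pn[y]; rewrite !inE => /andP[xy _] _.
by exists y.
Qed.

(** An original sees its neighbours and their copies, hence both [A] and [B]; a copy sees only [A]
    and the apex. So copies are compared by one trace, originals by two, and the apex is dominated
    through [B]. *)
Lemma gamma_mycielski_le (G : sgraph) (A B : {set G}) :
    B != set0 ->
    (forall x, nbh x :&: (A :|: B) != set0) ->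
    (forall x y, x \notin B -> y \notin B ->
       nbh x :&: A = nbh y :&: A -> x = y) ->
    (forall x y, x \notin A -> y \notin A ->
       nbh x :&: A = nbh y :&: A -> nbh x :&: B = nbh y :&: B -> x = y) ->
  gamma_LTD (mycielski G) <= #|A| + #|B| + 1.
Proof.
move=> /set0Pn[b bB] dom locB locA.
pose C : {set mycielski G} :=
  None |: ([set Some (inl v) | v in A] :|: [set Some (inr v) | v in B]).
have inlC v : (Some (inl v) \in C) = (v \in A).
  rewrite !inE /= mem_imset; last by move=> ? ? [].
  by case: imsetP => [[]//|_]; rewrite orbF.
have inrC v : (Some (inr v) \in C) = (v \in B).
  rewrite !inE /= [X in _ || X]mem_imset; last by move=> ? ? [].
  by case: imsetP => [[]|].
have noneC : None \in C by rewrite !inE.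
apply: (@leq_trans #|C|); last first.
  rewrite cardsU1 addnC; apply: leq_add; last exact: leq_b1.
  apply: leq_trans (leq_card_setU _ _) _.
  by apply: leq_add; apply: leq_imset_card.
have E (x y : mycielski G) : nbh x :&: C = nbh y :&: C ->
    forall z, z \in C -> adj x z = adj y z.
  by move=> e z zC; move/setP/(_ z): e; rewrite !in_setI zC !andbT !inE.
have trA (x y : G) (D : {set G}) : (forall z, z \in D -> adj x z = adj y z) ->
    nbh x :&: D = nbh y :&: D.
  move=> e; apply/setP => z; rewrite !inE.
  by case zD: (z \in D); rewrite ?andbF // e.
apply: gamma_LTD_le; apply/andP; split.
  apply/forallP => -[[v|v]|]; apply/set0Pn.
  - have /set0Pn[w] := dom v; rewrite !inE => /andP[vw /orP[wA|wB]].
      by exists (Some (inl w)); rewrite in_setI inlC wA andbT inE.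
    by exists (Some (inr w)); rewrite in_setI inrC wB andbT inE.
  - by exists None; rewrite in_setI noneC andbT inE.
  - by exists (Some (inr b)); rewrite in_setI inrC bB andbT inE.
apply/forallP => x; apply/forallP => y; apply/implyP => /and3P[xC yC].
apply: contraNneq => /E e.
case: x y xC yC e => [[x|x]|] [[y|y]|]; rewrite ?noneC ?inlC ?inrC // => xC yC e.
- rewrite (locA x y) //; apply: trA => z.
    by rewrite -inlC => /e.
  by rewrite -inrC => /e.
- by have := e _ noneC.
- by have := e _ noneC.
- rewrite (locB x y) //; apply: trA => z.
  by rewrite -inlC => /e.
Qed.

(* By injectivity at most one vertex has no neighbour in A; the copy of one of
   its neighbours is the only vertex needed besides A and the apex. *)
Lemma gamma_mycielski_open_locating (G : sgraph) (x0 : G) (A : {set G}) :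
    (forall x : G, exists y, adj x y) ->
    (forall x y, nbh x :&: A = nbh y :&: A -> x = y) ->
  gamma_LTD (mycielski G) <= #|A| + 2.
Proof.
move=> noiso injA.
have [b domb] : exists b, forall x, nbh x :&: A = set0 -> adj x b.
  have [x /eqP xA|nA] := pickP (fun x => nbh x :&: A == set0).
    have [b xb] := noiso x; exists b => y yA.
    by rewrite (injA y x) // yA.
  by exists x0 => x /eqP; rewrite nA.
suff : gamma_LTD (mycielski G) <= #|A| + #|[set b]| + 1 by rewrite cards1 -addnA.
apply: gamma_mycielski_le => [|x|x y _ _|x y _ _ ?]; rewrite ?setIUr ?setU_eq0.
- by rewrite -cards_eq0 cards1.
- have [/domb xb|//] := eqVneq (nbh x :&: A) set0; apply/set0Pn.
  by exists b; rewrite !inE xb eqxx.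
- exact: injA.
- by move=> _; apply: injA.
Qed.

(** [f] bounds the number of elements of [p] below its argument; telescoping leaves one-step
    increments, which are linear arithmetic. *)
Lemma card_ord_pred_le (n : nat) (p : pred nat) (f : nat -> nat) :
  (forall i, i < n -> f i + p i <= f i.+1) -> #|[set i : 'I_n | p i]| <= f n.
Proof.
move=> fS; rewrite -sum1dep_card big_mkcond /=.
rewrite (eq_bigr (fun i : 'I_n => nat_of_bool (p i)));
  last by move=> i _; case: (p i).
elim: n fS => [|n IHn] fS; first by rewrite big_ord0.
rewrite big_ord_recr /=; apply: leq_trans (fS n _) => //.
by rewrite leq_add2r IHn // => i /ltnW; apply: fS.
Qed.

Lemma nbhI_adj (G : sgraph) (A : {set G}) (x y z : G) :
  nbh x :&: A = nbh y :&: A -> z \in A -> adj x z = adj y z.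
Proof. by move=> /setP/(_ z); rewrite !inE => + zA; rewrite zA !andbT. Qed.

(** * Mycielski graphs of paths *)

Lemma path_no_isolated (n : nat) : 1 < n ->
  forall x : path_graph n, exists y, adj x y.
Proof.
move=> n1 x; have xn := ltn_ord x.
have [x0|x0] := posnP x.
  by exists (Ordinal n1); rewrite /= /path_adj /= x0.
have yn : x.-1 < n by lia.
by exists (Ordinal yn); rewrite /= /path_adj /=; lia.
Qed.

(** For [x < y] the only possible common neighbour is [x.+1 = y.-1]; any other neighbour inside the
    set would tell them apart. *)
Lemma path_traceP (n : nat) (p : pred nat) (x y : path_graph n) :
    nbh x :&: [set i | p (val i)] = nbh y :&: [set i | p (val i)] -> x < y ->
  [/\ 0 < x -> ~~ p x.-1, y.+1 < n -> ~~ p y.+1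
    & (y = x.+2 :> nat) \/ ~~ p x.+1 /\ ~~ p y.-1].
Proof.
move=> e xy; have yn := ltn_ord y.
have tr z : z < n -> p z ->
    (x.+1 == z) || (z.+1 == x) = (y.+1 == z) || (z.+1 == y).
  move=> zn pz; have := nbhI_adj (z := Ordinal zn : path_graph n) e.
  by rewrite inE => /(_ pz).
split.
- by move=> x0; apply/negP => /tr; lia.
- by move=> y0; apply/negP => /tr; lia.
- case: (eqVneq (y : nat) x.+2) => [|ne]; [by left | right].
  by split; apply/negP => /tr; lia.
Qed.

Lemma gamma_mycielski_path_le (n : nat) (p : pred nat) (f : nat -> nat) :
    1 < n -> (forall i, i < n -> f i + p i <= f i.+1) ->
    (forall x y, x < y -> y < n ->
       (0 < x -> ~~ p x.-1) -> (y.+1 < n -> ~~ p y.+1) ->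
       ~ (y = x.+2 \/ ~~ p x.+1 /\ ~~ p y.-1)) ->
  gamma_LTD (mycielski (path_graph n)) <= f n + 2.
Proof.
move=> n1 fS inj.
pose A : {set path_graph n} := [set i | p (val i)].
apply: (@leq_trans (#|A| + 2)); last by rewrite leq_add2r; apply: card_ord_pred_le.
apply: gamma_mycielski_open_locating (path_no_isolated n1) _.
  exact: (Ordinal n1).
move=> x y e; apply: val_inj => /=.
have [lt|lt|//] := ltngtP x y.
  by have [h1 h2 h3] := path_traceP e lt; case: (inj _ _ lt _ h1 h2 h3).
by have [h1 h2 h3] := path_traceP (esym e) lt; case: (inj _ _ lt _ h1 h2 h3).
Qed.

(** Residues 0 and 5 are left out, so missing vertices differ by -1, 0 or 1 modulo 6, never by 2 or
    4. Only the last vertex can have an empty trace. *)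
Lemma gamma_mycielski_path_mod6_le2 (n k r : nat) :
    n = 6 * k + r -> 1 <= k -> r <= 2 ->
  gamma_LTD (mycielski (path_graph n)) <= 4 * k + r.-1 + 2.
Proof.
move=> nE k1 r2.
pose f i := 4 * (i %/ 6) + minn 4 (i %% 6).-1.
have -> : 4 * k + r.-1 = f n by rewrite /f; lia.
apply: (@gamma_mycielski_path_le n (fun y => 0 < y %% 6 < 5)); rewrite /f.
- lia.
- by move=> i _; lia.
- by move=> x y xy yn /=; lia.
Qed.

(** The pattern for [r <= 2] would give [6 * k] and the last vertex the same trace, so the last
    missing pair is shifted by one, to [6 * k] and [6 * k + 1]. *)
Lemma gamma_mycielski_path_mod6_eq3 (n k : nat) : n = 6 * k + 3 -> 1 <= k ->
  gamma_LTD (mycielski (path_graph n)) <= 4 * k + 2 + 2.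
Proof.
move=> nE k1.
pose f i :=
  4 * (i %/ 6) + minn 4 (i %% 6).-1 + (6 * k <= i) - (6 * k + 2 <= i).
have -> : 4 * k + 2 = f n by rewrite /f; lia.
pose p y := (0 < y %% 6 < 5) && (y != 6 * k + 1) || (y == (6 * k).-1).
have zeroP z : ~~ p z ->
    [\/ z %% 6 = 0, z %% 6 = 5 /\ z <> (6 * k).-1 | z = 6 * k + 1].
  by rewrite /p => pz; case: (z =P 6 * k + 1) => ?; [apply: Or33
    | have [?|?] := posnP (z %% 6); [apply: Or31 | apply: Or32]]; lia.
apply: (@gamma_mycielski_path_le n p); rewrite /f.
- lia.
- by move=> i _; rewrite /p; lia.
move=> x y xy yn h1 h2.
have {}h1 : x = 0 \/ ~~ p x.-1 by case: posnP h1 => [|_ /(_ isT)]; [left|right].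
case=> [yE|[h3 _]].
  have {}h2 : n <= y.+1 \/ ~~ p y.+1.
    by case: ltnP h2 => [_ /(_ isT)|]; [right|left].
  case: h1 => [x0|/zeroP h1]; case: h2 => [y0|/zeroP h2].
  - lia.
  - by case: h2 => [?|[? ?]|?]; lia.
  - by case: h1 => [?|[? ?]|?]; lia.
  - by case: h1 => [?|[? ?]|?]; case: h2 => [?|[? ?]|?]; lia.
move/zeroP: h3 => h3; case: h1 => [x0|/zeroP h1].
  by case: h3 => [?|[? ?]|?]; lia.
by case: h1 => [?|[? ?]|?]; case: h3 => [?|[? ?]|?]; lia.
Qed.

(** Missing are 0 and the vertices congruent to 2 modulo 3. The only bad distance is between 0 and
    2; it gives vertex 1 the single empty trace. *)
Lemma gamma_mycielski_path_mod6_eq5 (n k : nat) : n = 6 * k + 5 -> 1 <= k ->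
  gamma_LTD (mycielski (path_graph n)) <= 4 * k + 3 + 2.
Proof.
move=> nE k1.
pose f i := (i - i %/ 3).-1.
have -> : 4 * k + 3 = f n by rewrite /f; lia.
apply: (@gamma_mycielski_path_le n (fun y => (y %% 3 < 2) && (0 < y))); rewrite /f.
- lia.
- by move=> i _; lia.
- by move=> x y xy yn /=; lia.
Qed.

Lemma gamma_mycielski_path_mod6_eq4 (n k : nat) : n = 6 * k + 4 -> 1 <= k ->
  gamma_LTD (mycielski (path_graph n)) <= 4 * k + 4.
Proof.
move=> nE k1.
(* Beyond [6 * k] only [6 * k + 2] stays in [A]: the traces of [6 * k] and [6 * k + 2] are empty,
   those of [6 * k + 1] and [6 * k + 3] coincide. [B] takes one vertex of each pair, which settles
   the copies. *)
pose p y := (0 < y %% 6 < 5) && (y != 6 * k + 1) && (y != 6 * k + 3).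
pose q y := (y == 6 * k) || (y == 6 * k + 1).
pose A : {set path_graph n} := [set i | p (val i)].
pose B : {set path_graph n} := [set i | q (val i)].
have cA : #|A| <= 4 * k + 1.
  pose f i :=
    4 * (i %/ 6) + minn 4 (i %% 6).-1 - (6 * k + 2 <= i) - (6 * k + 4 <= i).
  have -> : 4 * k + 1 = f n by rewrite /f; lia.
  by apply: card_ord_pred_le => i _; rewrite /f /p; lia.
have cB : #|B| <= 2.
  pose f i := (6 * k < i) + (6 * k + 1 < i).
  have -> : 2 = f n by rewrite /f; lia.
  by apply: card_ord_pred_le => i _; rewrite /f /q; lia.
have n1 : 1 < n by lia.
apply: (@leq_trans (#|A| + #|B| + 1)); last by lia.
clear cA cB.
have inj (x y : path_graph n) : x < y -> nbh x :&: A = nbh y :&: A ->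
    (x = 6 * k :> nat) /\ (y = 6 * k + 2 :> nat) \/
    (x = 6 * k + 1 :> nat) /\ (y = 6 * k + 3 :> nat).
  move=> xy /path_traceP/(_ xy)[]; have yn := ltn_ord y.
  have zeroP z : ~~ p z ->
      [\/ z %% 6 = 0, z %% 6 = 5, z = 6 * k + 1 | z = 6 * k + 3].
    rewrite /p => pz; case: (z =P 6 * k + 1) => ?; first exact: Or43.
    case: (z =P 6 * k + 3) => ?; first exact: Or44.
    by have [?|?] := posnP (z %% 6); [apply: Or41 | apply: Or42]; lia.
  have p2 : p (6 * k + 2) by rewrite /p; lia.
  move: (x : nat) (y : nat) xy yn => {}x {}y xy yn h1 h2.
  have {}h1 : x = 0 \/ ~~ p x.-1.
    by case: posnP h1 => [|_ /(_ isT)]; [left|right].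
  case=> [yE|[/zeroP h3 h4]]; last first.
    (* Here [x] is the midpoint of two missing vertices, and only [6 * k - 1], [6 * k + 1],
       [6 * k + 3] are two apart. *)
    have xE : x = 6 * k \/ x = 6 * k + 2.
      case: h1 => [x0|/zeroP h1]; first by case: h3 => ?; lia.
      by case: h1 => ?; case: h3 => ?; lia.
    have y3 : y = 6 * k + 3 -> p y.-1.
      by move=> ->; have -> : (6 * k + 3).-1 = 6 * k + 2 by lia.
    case: xE => xE; last by rewrite y3 in h4; lia.
    left; split=> //; case: (eqVneq y (6 * k + 2)) => // yN.
    have [yE|yE] : y = 6 * k + 1 \/ y = 6 * k + 3 by lia.
      have y1 : y.+1 = 6 * k + 2 by lia.
      by move: h2; rewrite y1 p2 => h2; have := h2 _; lia.
    by rewrite y3 in h4.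
  have {}h2 : n <= y.+1 \/ ~~ p y.+1.
    by case: ltnP h2 => [_ /(_ isT)|]; [right|left].
  case: h1 => [x0|/zeroP h1]; case: h2 => [y0|/zeroP h2].
  - lia.
  - by case: h2 => ?; lia.
  - by case: h1 => ?; lia.
  - by case: h1 => ?; case: h2 => ?; lia.
apply: gamma_mycielski_le.
- have bn : 6 * k < n by lia.
  by apply/set0Pn; exists (Ordinal bn); rewrite inE /q /= eqxx.
- move=> x; have xn := ltn_ord x; apply/set0Pn.
  have ex z (zn : z < n) : (x.+1 == z) || (z.+1 == x) -> p z || q z ->
      exists y, y \in nbh x :&: (A :|: B).
    by move=> xz pz; exists (Ordinal zn); rewrite !inE /= /path_adj xz.
  have [h|h] := boolP ((x.+1 < n) && (p x.+1 || q x.+1)).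
    by case/andP: h => h1 h2; apply: (ex _ h1); rewrite ?eqxx.
  by apply: (ex x.-1); rewrite /p /q in h *; lia.
- move=> x y xB yB e; apply: val_inj => /=.
  have [lt|lt|//] := ltngtP x y.
    have [[xE _]|[xE _]] := inj _ _ lt e;
      by move: xB; rewrite inE /q /= xE eqxx ?orbT.
  have [[yE _]|[yE _]] := inj _ _ lt (esym e);
    by move: yB; rewrite inE /q /= yE eqxx ?orbT.
(* Of the first colliding pair, [6 * k + 2] lies in [A]; in the second, only [6 * k + 1] is adjacent
   to [6 * k], which is in [B]. *)
- have locA (x y : path_graph n) : x < y -> y \notin A ->
      nbh x :&: A = nbh y :&: A -> ~ (nbh x :&: B = nbh y :&: B).
    move=> lt yA e /path_traceP/(_ lt)[qx _ _].
    have [[xE yE]|[xE _]] := inj _ _ lt e.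
      by move: yA; rewrite inE /p /= yE; lia.
    by move: qx; rewrite /q /= xE; lia.
  move=> x y xA yA e e'; apply: val_inj => /=.
  have [lt|lt|//] := ltngtP x y; first by case: (locA _ _ lt yA).
  by case: (locA _ _ lt xA).
Qed.

(** * Mycielski graphs of cycles *)

Definition cyc_next (n i j : nat) := (i.+1 == j) || (i.+1 == n) && (j == 0).

(** Trades the modulus hidden in [ordS] for a case distinction at the seam, within reach of linear
    arithmetic. *)
Lemma cycle_adjE (n : nat) (x y : 'I_n) : 2 < n ->
  cycle_adj x y = cyc_next n x y || cyc_next n y x.
Proof.
move=> n2; rewrite /cycle_adj /cyc_next -!val_eqE /=.
have [xn yn] := (ltn_ord x, ltn_ord y).
have modS z : z < n -> z.+1 %% n = if z.+1 == n then 0 else z.+1.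
  by move=> zn; case: eqP => [->|ne]; rewrite ?modnn // modn_small; lia.
by rewrite !modS //; do 2 case: ifP => ?; lia.
Qed.

Lemma cycle_no_isolated (n : nat) : 2 < n ->
  forall x : cycle_graph n, exists y, adj x y.
Proof.
move=> n2 x; have xn := ltn_ord x.
have [x0|x0] := posnP x.
  have yn : 1 < n by lia.
  by exists (Ordinal yn); rewrite /= cycle_adjE //= x0.
have yn : x.-1 < n by lia.
by exists (Ordinal yn); rewrite /= cycle_adjE // /cyc_next /=; lia.
Qed.

(** No trace is empty, since the neighbours of a vertex are two apart. If distinct [x] and [y] share
    a neighbour, their outer neighbours are four apart, so one lies in the set; it separates them,
    as being adjacent to both would force [n = 4]. *)
Lemma gamma_mycielski_cycle_le (n : nat) (p : pred nat) (f : nat -> nat) :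
    2 < n -> n != 4 -> (forall i, i < n -> f i + p i <= f i.+1) ->
    (forall z w, z < w -> w < n -> ~~ p z -> ~~ p w ->
       [&& w != z + 2, w != z + 4, w + 2 != z + n & w + 4 != z + n]) ->
  gamma_LTD (mycielski (cycle_graph n)) <= f n + 2.
Proof.
move=> n2 n4 fS sepZ.
pose A : {set cycle_graph n} := [set i | p (val i)].
apply: (@leq_trans (#|A| + 2)); last by rewrite leq_add2r; apply: card_ord_pred_le.
have n0 : 0 < n by lia.
apply: gamma_mycielski_open_locating (cycle_no_isolated n2) _.
  exact: (Ordinal n0).
move=> x y e; apply: val_inj => /=.
pose nxt := cyc_next n.
have tr z : z < n -> p z -> nxt x z || nxt z x = nxt y z || nxt z y.
  move=> zn pz; have := nbhI_adj (z := Ordinal zn : cycle_graph n) e.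
  by rewrite inE => /(_ pz); rewrite /= !cycle_adjE.
have [xn yn] := (ltn_ord x, ltn_ord y).
move: (x : nat) (y : nat) xn yn tr => {e A}x {}y xn yn tr.
have nxtP i j : nxt i j -> i.+1 = j \/ i.+1 = n /\ j = 0.
  by case/orP => [/eqP|/andP[/eqP ? /eqP]]; [left | right].
have succ z : z < n -> exists2 s, s < n & nxt z s.
  move=> zn; case: (eqVneq z.+1 n) => zE;
    last by exists z.+1; rewrite /nxt /cyc_next; lia.
  by exists 0; rewrite // /nxt /cyc_next zE !eqxx orbT.
have pred z : z < n -> exists2 s, s < n & nxt s z.
  move=> zn; case: (posnP z) => z0;
    last by exists z.-1; rewrite /nxt /cyc_next; lia.
  by exists n.-1; rewrite /nxt /cyc_next; lia.
have nxt_fun i j j' : j < n -> j' < n -> nxt i j -> nxt i j' -> j = j'.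
  by move=> jn j'n /nxtP[?|[? ?]] /nxtP[?|[? ?]]; lia.
have nxt_inj i i' j : nxt i j -> nxt i' j -> i = i'.
  by move=> /nxtP[?|[? ?]] /nxtP[?|[? ?]]; lia.
have no4 a b c d : nxt a b -> nxt b c -> nxt c d -> ~~ nxt d a.
  move=> ab bc cd; apply/negP => da; move/eqP: n4; apply.
  by case/nxtP: ab => [?|[? ?]]; case/nxtP: bc => [?|[? ?]];
    case/nxtP: cd => [?|[? ?]]; case/nxtP: da => [?|[? ?]]; lia.
have far2 a b c : a < n -> c < n -> nxt a b -> nxt b c ->
    ~~ p a -> ~~ p c -> False.
  move=> an cn ab bc pa pc; have [ac|ca|ac] := ltngtP a c.
  - have := sepZ _ _ ac cn pa pc.
    by case/nxtP: ab => [?|[? ?]]; case/nxtP: bc => [?|[? ?]]; lia.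
  - have := sepZ _ _ ca an pc pa.
    by case/nxtP: ab => [?|[? ?]]; case/nxtP: bc => [?|[? ?]]; lia.
  - by case/nxtP: ab => [?|[? ?]]; case/nxtP: bc => [?|[? ?]]; lia.
have far4 a b c d e : a < n -> e < n ->
    nxt a b -> nxt b c -> nxt c d -> nxt d e -> ~~ p a -> ~~ p e -> False.
  move=> an en ab bc cd de pa pe.
  have := no4 _ _ _ _ ab bc cd; have [ae|ea|ae] := ltngtP a e; last first.
  - by rewrite ae de.
  - move=> _; have := sepZ _ _ ea an pe pa.
    by case/nxtP: ab => [?|[? ?]]; case/nxtP: bc => [?|[? ?]];
      case/nxtP: cd => [?|[? ?]]; case/nxtP: de => [?|[? ?]]; lia.
  - move=> _; have := sepZ _ _ ae en pa pe.
    by case/nxtP: ab => [?|[? ?]]; case/nxtP: bc => [?|[? ?]];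
      case/nxtP: cd => [?|[? ?]]; case/nxtP: de => [?|[? ?]]; lia.
(* The hard case is the walk [t], [x'], [s], [y'], [w], whose ends cannot both be missing. *)
have loc x' y' : x' < n -> y' < n ->
    (forall z, z < n -> p z -> nxt x' z || nxt z x' = nxt y' z || nxt z y') ->
    forall s, s < n -> nxt x' s -> p s -> x' = y'.
  move=> x'n y'n tr' s sn xs ps.
  have /esym := tr' s sn ps; rewrite xs => /orP[ys|sy]; first exact: nxt_inj xs ys.
  have [t tn tx] := pred _ x'n; have [w wn yw] := succ _ y'n.
  have [pt|pt] := boolP (p t).
    have := tr' t tn pt; rewrite tx orbT => /esym/orP[yt|ty].
      by have := no4 _ _ _ _ tx xs sy; rewrite yt.
    exact: nxt_fun tx ty.
  have [pw|pw] := boolP (p w); last by case: (far4 _ _ _ _ _ tn wn tx xs sy yw).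
  have := tr' w wn pw; rewrite yw => /orP[xw|wx].
    by apply: (nxt_inj _ _ s xs); rewrite (nxt_fun _ _ _ sn wn xs xw).
  by have := no4 _ _ _ _ xs sy yw; rewrite wx.
have [s sn xs] := succ x xn; have [t tn tx] := pred x xn.
have [ps|ps] := boolP (p s); first exact: loc xs ps.
have [pt|pt] := boolP (p t); last by case: (far2 _ _ _ tn sn tx xs pt ps).
have := tr t tn pt; rewrite tx orbT => /esym/orP[yt|ty]; last exact: nxt_fun tx ty.
(* Now [t] is the successor of [y], so [x] and [y] exchange roles. *)
by apply/esym/(loc y x yn xn _ t) => // z zn pz; rewrite tr.
Qed.

(** Leaving out residue 2 modulo 3 would put 2 and [n - 2] four steps apart across the seam. With
    residues 3 and 4 modulo 6 left out, the gap there is 6. *)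
Lemma gamma_mycielski_cycle_mod6_eq1 (n : nat) : 2 < n -> n %% 6 = 1 ->
  gamma_LTD (mycielski (cycle_graph n)) <= n - n %/ 3 + 2.
Proof.
move=> n2 nr.
pose f i := i - 2 * (i %/ 6) - minn 2 (i %% 6 - 3).
have -> : n - n %/ 3 = f n by rewrite /f; lia.
apply: (@gamma_mycielski_cycle_le n (fun y => ~~ (3 <= y %% 6 <= 4))); rewrite /f.
- by [].
- by apply/eqP => n4; rewrite n4 in nr.
- by move=> i _; lia.
- by move=> z w zw wn /=; lia.
Qed.

(** Period 3 closes up well unless [n] is 4 modulo 6, where 2 and [n - 2] are again four steps
    apart; restoring [n.-2] costs one vertex. *)
Lemma gamma_mycielski_cycle_mod6_neq1 (n : nat) :
    2 < n -> n != 4 -> n %% 6 != 1 ->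
  gamma_LTD (mycielski (cycle_graph n)) <= n - n %/ 3 + (n %% 6 == 4) + 2.
Proof.
move=> n2 n4 nr.
pose f i := i - i %/ 3 + (n %% 6 == 4) * (n.-2 < i).
have -> : n - n %/ 3 + (n %% 6 == 4) = f n by rewrite /f; lia.
apply: (@gamma_mycielski_cycle_le n (fun y => (y %% 3 < 2) || (y == n.-2)));
  rewrite /f //.
- by move=> i i_n; case: (eqVneq (n %% 6) 4) => ?; lia.
- by move=> z w zw wn /=; lia.
Qed.

(** Opposite vertices of the 4-cycle are twins, so traces are never injective. [B] takes one of each
    twin pair, and 0 separates the copies of 2 and 3. *)
Lemma gamma_mycielski_C4 : gamma_LTD (mycielski (cycle_graph 4)) <= 6.
Proof.
pose A : {set cycle_graph 4} := [set i | (i : 'I_4) < 3].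
pose B : {set cycle_graph 4} := [set i | (i : 'I_4) < 2].
have cA : #|A| <= 3.
  by apply: (@card_ord_pred_le 4 (fun i => i < 3) (minn 3)) => i _; lia.
have cB : #|B| <= 2.
  by apply: (@card_ord_pred_le 4 (fun i => i < 2) (minn 2)) => i _; lia.
apply: (@leq_trans (#|A| + #|B| + 1)); last by lia.
have tr (x y : cycle_graph 4) (D : {set cycle_graph 4}) :
  nbh x :&: D = nbh y :&: D -> forall z, z \in D -> cycle_adj x z = cycle_adj y z.
  by move=> e z; apply: nbhI_adj.
apply: gamma_mycielski_le.
- by apply/set0Pn; exists (@Ordinal 4 0 isT); rewrite inE.
- move=> x; apply/set0Pn; case: x => -[|[|[|[|//]]]] xn;
    [exists (@Ordinal 4 1 isT)|exists (@Ordinal 4 0 isT)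
    |exists (@Ordinal 4 1 isT)|exists (@Ordinal 4 0 isT)]; by rewrite !inE.
- move=> x y; rewrite !inE -!leqNgt => xB yB /tr/(_ (@Ordinal 4 0 isT)).
  rewrite inE => /(_ isT); rewrite !cycle_adjE // /cyc_next /= => e.
  by apply: val_inj => /=; move: (ltn_ord x) (ltn_ord y); lia.
- move=> x y; rewrite !inE -!leqNgt => xB yB _ _.
  by apply: val_inj => /=; move: (ltn_ord x) (ltn_ord y); lia.
Qed.

Theorem theorem8 :
  (forall n k r : nat, n = 6 * k + r -> 1 <= k -> r <= 5 ->
     gamma_LTD (mycielski (path_graph n)) <=
       (if r == 0 then 4 * k + 2
        else if r <= 3 then 4 * k + r + 1
        else 4 * k + r)) /\
  (forall n : nat, 3 <= n ->
     gamma_LTD (mycielski (cycle_graph n)) <=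
       (if odd n then n - n %/ 3 + 2
        else n - 2 * (n %/ 6) + 2)).
Proof.
split.
  move=> n k [|[|[|[|[|[|//]]]]]] nE k1 _ /=.
  - by have := gamma_mycielski_path_mod6_le2 nE k1 isT; lia.
  - by have := gamma_mycielski_path_mod6_le2 nE k1 isT; lia.
  - by have := gamma_mycielski_path_mod6_le2 nE k1 isT; lia.
  - by have := gamma_mycielski_path_mod6_eq3 nE k1; lia.
  - exact: gamma_mycielski_path_mod6_eq4.
  - by have := gamma_mycielski_path_mod6_eq5 nE k1; lia.
move=> n n2.
have [->|n4] := eqVneq n 4; first exact: gamma_mycielski_C4.
have [nr|nr] := eqVneq (n %% 6) 1.
  have -> : odd n by lia.
  exact: gamma_mycielski_cycle_mod6_eq1.
apply: leq_trans (gamma_mycielski_cycle_mod6_neq1 n2 n4 nr) _.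
(* When [n] is 4 modulo 6, [n %/ 3] is [2 * (n %/ 6) + 1], which absorbs the restored vertex. *)
by case: ifP; lia.
Qed.
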